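(* Let $\alpha$ be an admissible assigning of a graph $G$ and $\prec$ a linear ordering on $E(G)$. Then \[ \tau(G,\alpha;k)=\sum_{X\in \mathcal{E}(G,\prec)}\delta(G,\alpha;X)(-1)^{|X|}(k-1)^{r(G)-r(X)} \] and \[ P(G,\alpha;k)=\sum_{X\in \mathcal{E}(G,\prec)}\delta(G,\alpha;X)(-1)^{|X|}(k-1)^{c(G|X)}, \] where $r$ is the rank function of $G$ given by $r(X):=|V(G)|-c(G|X)$ for $X\subseteq E(G)$.
   Context: Graphs are finite and may have loops and multiple edges; Abelian groups $A$ are additive and finite; $D$ is an arbitrary but fixed orientation of $G$. A cycle of $G$ is a connected 2-regular subgraph (a loop with its vertex is a cycle with one edge; two parallel edges form a cycle); $\mathcal{C}(G)$ is the set of cycles. An assigning of $G$ is a map $\alpha:\mathcal{C}(G)\to\{0,1\}$. For each cycle $C$ fix one of its two directions $o(C)$ and define $\eta_{D(C)}:E(G)\to\{0,\pm1\}$ by $\eta_{D(C)}(e)=1$ if $e\in E(C)$ and the direction of $e$ under $D$ is consistent with $o(C)$, $-1$ if $e\in E(C)$ and the direction of $e$ is opposite to $o(C)$, and $0$ if $e\notin E(C)$. For $f:E(G)\to A$, set $\alpha_{D,f}(C)=0$ if $\sum_{e\in E(C)}\eta_{D(C)}(e)f(e)=0$ and $\alpha_{D,f}(C)=1$ otherwise (this does not depend on the choice of the directions $o(C)$). An assigning $\alpha$ is admissible if $\alpha=\alpha_{D,f}$ for some finite Abelian group $A$ and some $f:E(G)\to A$. A subgraph $H$ is $\alpha$-compatible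 if $\alpha(C)=0$ for every cycle $C$ of $H$. $c(H)$ is the number of components of $H$; $G|X$ is the spanning subgraph of $G$ with edge set $X$; $r(G)=|V(G)|-c(G)$, and $r(H)=|V(G)|-c(H)$ for a spanning subgraph $H$. Define \[ P(G,\alpha;k):=\sum_{H}(-1)^{|E(H)|}k^{c(H)},\qquad \tau(G,\alpha;k):=\sum_{H}(-1)^{|E(H)|}k^{r(G)-r(H)}, \] both sums over all $\alpha$-compatible spanning subgraphs $H$ of $G$ (spanning: $V(H)=V(G)$). A bond of $G$ is a minimal nonempty edge cut, i.e. a minimal nonempty set of edges whose removal increases the number of components. For a linear ordering $\prec$ of $E(G)$, $\min(Y)$ is the $\prec$-minimal element of $Y$, and \[ \mathcal{E}(G,\prec):=\big\{X\subseteq E(G) : X\cap C^*\neq\{\min(C^* )\}\text{ for all bonds } C^*\text{ of }G\big\}. \] For $X\subseteq E(G)$, $\delta(G,\alpha;X):=0$ if there is a cycle $C\in\mathcal{C}(G)$ with $E(C)\subseteq X$ and $\alpha(C)=1$, and $\delta(G,\alpha;X):=1$ otherwise.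
   Formalization: In the formula for P, the factor (k-1)^{c(G|X)} is replaced by k^{c(G)}(k-1)^{c(G|X)-c(G)}, since the printed formula is false: for one vertex without edges P = k, but the printed sum is k-1. *)

(* Defs.v *)
From mathcomp Require Import all_boot all_order all_algebra.
Set Implicit Arguments.
Unset Strict Implicit.
Unset Printing Implicit Defensive.
Import GRing.Theory.
Local Open Scope ring_scope.

(* A finite graph with loops and multiple edges.  The graph is undirected: the
   order of the two components of [ends e] only names the two ends of e, so
   that each edge, loops included, has exactly two directions. *)
Record mgraph := MGraph {
  vert : finType;
  edge : finType;
  ends : edge -> vert * vert
}.

(* A direction of every edge: [true] goes from (ends e).1 to (ends e).2. *)
Definition orientation (G : mgraph) := edge G -> bool.

Definition etail (G : mgraph) (D : orientation G) (e : edge G) : vert G :=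
  if D e then (ends e).1 else (ends e).2.

Definition ehead (G : mgraph) (D : orientation G) (e : edge G) : vert G :=
  if D e then (ends e).2 else (ends e).1.

Definition subgraph_axiom (G : mgraph)
    (H : {set vert G} * {set edge G}) : bool :=
  [forall e in H.2, ((ends e).1 \in H.1) && ((ends e).2 \in H.1)].

Definition subgraph (G : mgraph) : Type :=
  {H : {set vert G} * {set edge G} | subgraph_axiom H}.

Definition VS (G : mgraph) (H : subgraph G) : {set vert G} := (val H).1.
Definition ES (G : mgraph) (H : subgraph G) : {set edge G} := (val H).2.

Definition adj (G : mgraph) (H : subgraph G) : rel (vert G) :=
  fun u v => [exists e in ES H, (ends e == (u, v)) || (ends e == (v, u))].

Definition ncomp (G : mgraph) (H : subgraph G) : nat :=
  n_comp (adj H) (mem (VS H)).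

(* Loops count twice. *)
Definition degree (G : mgraph) (H : subgraph G) (v : vert G) : nat :=
  (\sum_(e in ES H) (((ends e).1 == v) + ((ends e).2 == v)))%N.

Definition is_cycle (G : mgraph) (H : subgraph G) : bool :=
  (ncomp H == 1%N) && [forall v in VS H, degree H v == 2%N].

Definition gcycle (G : mgraph) : Type := {C : subgraph G | is_cycle C}.

Definition VC (G : mgraph) (C : gcycle G) : {set vert G} := VS (val C).
Definition EC (G : mgraph) (C : gcycle G) : {set edge G} := ES (val C).

Definition assigning (G : mgraph) := gcycle G -> bool.

(* Only the values of o on the edges of C matter. *)
Definition is_direction (G : mgraph) (C : gcycle G) (o : orientation G) : bool :=
  [forall v in VC C,
     (#|[set e in EC C | etail o e == v]| == 1%N)
     && (#|[set e in EC C | ehead o e == v]| == 1%N)].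

Definition eta (G : mgraph) (D : orientation G) (o : gcycle G -> orientation G)
    (C : gcycle G) (e : edge G) : int :=
  if e \in EC C then (if D e == o C e then 1 else -1) else 0.

Definition assigning_of (G : mgraph) (D : orientation G)
    (o : gcycle G -> orientation G) (A : finZmodType) (f : edge G -> A) :
    assigning G :=
  fun C => (\sum_(e in EC C) f e *~ eta D o C e) != 0.

Definition admissible (G : mgraph) (D : orientation G)
    (o : gcycle G -> orientation G) (alpha : assigning G) : Prop :=
  exists (A : finZmodType) (f : edge G -> A), alpha =1 assigning_of D o f.

Definition is_cycle_of (G : mgraph) (H : subgraph G) (C : gcycle G) : bool :=
  (VC C \subset VS H) && (EC C \subset ES H).

Definition compatible (G : mgraph) (alpha : assigning G) (H : subgraph G) :
    bool :=
  [forall C : gcycle G, is_cycle_of H C ==> ~~ alpha C].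

Definition spanning (G : mgraph) (H : subgraph G) : bool := VS H == setT.

Fact restr_subproof (G : mgraph) (X : {set edge G}) :
  subgraph_axiom ([set: vert G], X).
Proof. by apply/forall_inP => e _; rewrite !inE. Qed.

(* The spanning subgraph G|X. *)
Definition restr (G : mgraph) (X : {set edge G}) : subgraph G :=
  Sub ([set: vert G], X) (restr_subproof X).

(* G as a subgraph of itself. *)
Definition whole (G : mgraph) : subgraph G := restr [set: edge G].

(* For spanning H. *)
Definition rk (G : mgraph) (H : subgraph G) : nat := (#|vert G| - ncomp H)%N.

(* The polynomials, with the indeterminate 'X in the role of k. *)
Definition assigning_poly (G : mgraph) (alpha : assigning G) : {poly int} :=
  \sum_(H : subgraph G | spanning H && compatible alpha H)
    (-1) ^+ #|ES H| * 'X ^+ ncomp H.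

Definition tension_poly (G : mgraph) (alpha : assigning G) : {poly int} :=
  \sum_(H : subgraph G | spanning H && compatible alpha H)
    (-1) ^+ #|ES H| * 'X ^+ (rk (whole G) - rk H).

Definition bond (G : mgraph) (B : {set edge G}) : bool :=
  minset (fun F : {set edge G} =>
    (F != set0) && (ncomp (whole G) < ncomp (restr (~: F)))%N) B.

Definition linear_order (T : eqType) (prec : rel T) : Prop :=
  [/\ irreflexive prec, transitive prec
    & forall x y, x != y -> prec x y || prec y x].

(* The singleton {min(Y)} when prec is a linear order and Y is nonempty. *)
Definition min1 (T : finType) (prec : rel T) (Y : {set T}) : {set T} :=
  [set e in Y | [forall e' in Y, (e' != e) ==> prec e e']].

Definition Efam (G : mgraph) (prec : rel (edge G)) : {set {set edge G}} :=
  [set X | [forall B : {set edge G}, bond B ==> (X :&: B != min1 prec B)]].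

Definition delta (G : mgraph) (alpha : assigning G) (X : {set edge G}) : nat :=
  if [exists C : gcycle G, (EC C \subset X) && alpha C] then 0%N else 1%N.

(* Main.v *)
Require Import Defs.
From mathcomp Require Import all_boot all_order all_algebra.
From mathcomp Require Import ring zify.
Import GRing.Theory.
Local Open Scope ring_scope.
Set Implicit Arguments.
Unset Strict Implicit.
Unset Printing Implicit Defensive.

(** The proof groups all edge sets into Boolean intervals, one for each member
    of [Efam prec].

    Call an edge e active for Z when some bond that has e as its least edge
    avoids Z apart from e.  By the correspondence between bonds and hyperplanes
    of the cycle matroid ([bond_unspanned], [bond_exists]), this says that e is
    not spanned by the other edges of Z together with the edges smaller than e,
    and that is the definition used below.  A set X belongs to [Efam prec] exactly
    when none of its elements is active for X ([Efam_active]).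

    By the exchange property of spanning, adding to X edges that are active for
    X does not change which edges are active ([active_setU]).  So every Z lies in
    exactly one interval from X to the union of X and [active X] with X in
    [Efam prec], the one with X obtained from Z by deleting the edges active for
    Z.  Inside such an interval three things are known.
    - Each added edge is unspanned when it is added, hence lowers the number of
      components by exactly one ([comps_setU_active]).
    - Such an edge lies on no cycle of the enlarged set, because an edge of a cycle
      is spanned by the rest of the cycle ([cycle_edge_spanned]); hence
      compatibility is constant on the interval ([compatible_setU_active]).
    - The top of the interval has as few components as G
      ([comps_setU_active_full]), so [active X] has c(G|X) - c(G) elements.

    The terms of an interval therefore sum to a binomial expansion in which 'X
    becomes 'X - 1 ([expr_signed_subset_sum]), which gives
    [compatible_expansion].  Both formulas are this identity, the second one
    multiplied by 'X ^+ c(G). *)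

(** * Finite sets and signed sums over subsets *)

Lemma subset_induction (T : finType) (A : {set T}) (P : {set T} -> Prop) :
  P set0 ->
  (forall a (J : {set T}), a \in A -> J \subset A -> a \notin J -> P J -> P (a |: J)) ->
  forall J : {set T}, J \subset A -> P J.
Proof.
move=> P0 PU J; move: {2}#|J| (erefl #|J|) => n.
elim: n J => [|n IHn] J; first by move/eqP; rewrite cards_eq0 => /eqP ->.
move=> cJ sJA; have [a aJ] : exists a, a \in J by apply/card_gt0P; rewrite cJ.
rewrite -(setD1K aJ); have sJ'A : J :\ a \subset A.
  by apply: subset_trans sJA; apply: subsetDl.
apply: PU => //; [exact: (subsetP sJA) | by rewrite !inE eqxx |].
by apply: IHn => //; move: cJ; rewrite (cardsD1 a) aJ => -[].
Qed.

(** An element with the fewest predecessors is least. *)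
Lemma linear_order_min (T : finType) (prec : rel T) (Y : {set T}) :
  linear_order prec ->
  Y != set0 -> exists2 e, e \in Y & forall g, g \in Y -> ~~ prec g e.
Proof.
case=> prec_irr prec_trans _ /set0Pn[e0 e0Y].
pose down e := [set g | prec g e].
case: (@arg_minnP _ e0 (mem Y) (fun e => #|down e|) e0Y) => e eY min_e.
exists e => // g gY; apply/negP => ge; have := min_e g gY; apply/negP; rewrite -ltnNge.
apply: proper_card; apply/properP; split.
  by apply/subsetP => h; rewrite !inE => /prec_trans; apply.
by exists g; rewrite !inE ?ge ?prec_irr.
Qed.

(** Expansion of the product over A of (x - 1), written over the whole type with
    the factor 0 + 1 outside A to fit the distributivity law. *)
Lemma expr_signed_subset_sum (R : comNzRingType) (T : finType) (A : {set T}) (x : R) :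
  \sum_(J : {set T} | J \subset A) (-1) ^+ #|J| * x ^+ (#|A| - #|J|) =
  (x - 1) ^+ #|A|.
Proof.
have -> : (x - 1) ^+ #|A| =
    \prod_i ((if i \in A then -1 else 0) + (if i \in A then x else 1)).
  rewrite -prodr_const big_mkcond; apply: eq_bigr => i _.
  by case: ifP => _; rewrite ?add0r // addrC.
transitivity (\sum_(J : {set T}) \prod_i (if i \in J then if i \in A then -1 else 0
                                         else if i \in A then x else 1)).
2: by rewrite bigA_distr.
rewrite [RHS](bigID (fun J : {set T} => J \subset A)) /=.
rewrite [X in _ + X]big1 ?addr0.
  apply: eq_bigr => J /setIidPr sJA.
  rewrite (bigID (mem J)) /=; congr (_ * _).
    rewrite -prodr_const; apply: eq_bigr => i iJ.
    by rewrite iJ; move: iJ; rewrite -{1}sJA => /setIP[-> _].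
  have -> : (#|A| - #|J| = #|A :\: J|)%N by rewrite cardsD sJA.
  rewrite -prodr_const big_mkcond [RHS]big_mkcond; apply: eq_bigr => i _.
  by rewrite !inE; case: (i \in J).
move=> J /subsetPn[i iJ iA]; rewrite (bigD1 i) //= iJ (negbTE iA) mul0r //.
Qed.

(** * Connectivity of spanning subgraphs *)

Section Connectivity.

Variable G : mgraph.
Implicit Types (X Y Z : {set edge G}) (e f g : edge G) (x y : vert G).

Definition conn X : rel (vert G) := connect (adj (restr X)).

(** The closure operator of the cycle matroid of G, as a relation. *)
Definition spans X e : bool := conn X (ends e).1 (ends e).2.

Definition comps X : nat := ncomp (restr X).

Lemma adj_restrP X x y :
  reflect (exists2 e, e \in X & ends e = (x, y) \/ ends e = (y, x))
          (adj (restr X) x y).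
Proof.
apply: (iffP exists_inP) => -[e eX ends_e]; exists e => //.
- by case/orP: ends_e => /eqP ->; [left | right].
- by case: ends_e => ->; rewrite eqxx ?orbT.
Qed.

Lemma conn_sym X : connect_sym (adj (restr X)).
Proof.
apply: sym_connect_sym => x y.
by apply/adj_restrP/adj_restrP => -[e eX [] ends_e]; exists e; auto.
Qed.

Lemma connC X x y : conn X x y = conn X y x.
Proof. exact: conn_sym. Qed.

Lemma spans_mem X e : e \in X -> spans X e.
Proof.
by move=> eX; apply/connect1/adj_restrP; exists e => //; left; case: (ends e).
Qed.

Lemma conn_sub X Y x y :
  (forall e, e \in X -> spans Y e) -> conn X x y -> conn Y x y.
Proof.
move=> spXY; apply: connect_sub => {}x {}y /adj_restrP[e /spXY + ends_e].
rewrite /spans; case: ends_e => -> //=.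
by rewrite /conn conn_sym.
Qed.

Lemma spans_trans X Y e :
  (forall f, f \in X -> spans Y f) -> spans X e -> spans Y e.
Proof. exact: conn_sub. Qed.

Lemma spans_subset X Y e : X \subset Y -> spans X e -> spans Y e.
Proof.
by move=> /subsetP sXY; apply: spans_trans => f /sXY; apply: spans_mem.
Qed.

(** A path that uses e can be shortened to use it once, in one of its two
    directions. *)
Lemma conn_setU1 X e x y :
  conn (e |: X) x y =
    [|| conn X x y, conn X x (ends e).1 && conn X (ends e).2 y
      | conn X x (ends e).2 && conn X (ends e).1 y].
Proof.
have connW u v : conn X u v -> conn (e |: X) u v.
  by apply: conn_sub => f fX; apply: spans_mem; rewrite !inE fX orbT.
have conn_e : conn (e |: X) (ends e).1 (ends e).2.
  by apply: spans_mem; rewrite !inE eqxx.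
apply/idP/idP; last first.
  case/or3P => [/connW // | |] /andP[/connW xe /connW ey].
    exact: connect_trans xe (connect_trans conn_e ey).
  apply: connect_trans xe (connect_trans _ ey).
  by rewrite conn_sym.
case/connectP=> p + ->; elim: p x => [|z p IHp] x /=.
  by rewrite /conn connect0.
case/andP=> /adj_restrP[f + ends_f] /IHp{IHp}; set w := last z p.
rewrite in_setU1; case/predU1P => [f_e | fX].
  (* Crossing e from one end puts x at that end of e; the three ways to go on
     from the other end each give one of the three cases. *)
  by rewrite -f_e; case: ends_f => -> /=;
     case/or3P => [-> | /andP[_ ->] | /andP[_ ->]]; rewrite /conn connect0 ?orbT.
have xz : conn X x z.
  by apply/connect1/adj_restrP; exists f.
by rewrite /conn !(same_connect (@conn_sym X) xz).
Qed.

(** The exchange property of the cycle matroid: a path between the ends of e that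
    needs f can be rerouted, through e, into a path between the ends of f. *)
Lemma spans_exchange X e f :
  spans (f |: X) e -> ~~ spans X e -> spans (e |: X) f.
Proof.
rewrite /spans !conn_setU1 /conn => /orP[-> // | + _].
rewrite !(@conn_sym X (ends f).1) ![connect _ (ends f).2 _]conn_sym.
by case/orP => /andP[-> ->]; rewrite ?orbT // andbC.
Qed.

(** * The number of components *)

Lemma eq_comps X Y :
  (forall e, e \in X -> spans Y e) -> (forall e, e \in Y -> spans X e) ->
  comps X = comps Y.
Proof.
move=> spXY spYX; apply: eq_n_comp => x y.
by apply/idP/idP; apply: conn_sub.
Qed.

Lemma comps_spanned X e : spans X e -> comps (e |: X) = comps X.
Proof.
move=> spXe; apply: eq_comps => f; first by case/setU1P=> [-> | /spans_mem].
by move=> fX; apply: spans_mem; rewrite !inE fX orbT.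
Qed.

(** An edge between two different components merges them and leaves the other
    components as they are. *)
Lemma comps_unspanned X e : ~~ spans X e -> comps X = (comps (e |: X)).+1.
Proof.
move=> nspXe; set u := (ends e).1; set v := (ends e).2.
(* The vertices of the two components that e merges. *)
pose a := closure (adj (restr X)) (pred2 u v).
have conn_u x : conn (e |: X) u x = conn X u x || conn X v x.
  rewrite conn_setU1 -/u -/v -/(spans X e) (negbTE nspXe) orbF.
  by rewrite {2}/conn connect0.
have aE x : (x \in a) = conn (e |: X) u x.
  rewrite conn_u !(connC _ _ x).
  apply/pred0Pn/orP => [[y /andP[/= xy /orP[] /eqP y_eq]] | [xu | xv]].
  - by left; rewrite -y_eq.
  - by right; rewrite -y_eq.
  - by exists u; rewrite !inE eqxx andbT.
  - by exists v; rewrite !inE eqxx orbT andbT.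
have compsE Y : comps Y =
    (n_comp (adj (restr Y)) a + n_comp (adj (restr Y)) [predC a])%N.
  rewrite -n_compC; apply: eq_n_comp_r => x.
  by rewrite /VS /= !inE.
rewrite !compsE n_comp_closure2; last exact: conn_sym.
rewrite [connect _ _ _](negbTE nspXe).
have -> : n_comp (adj (restr (e |: X))) a = 1%N.
  by rewrite -(n_comp_connect (@conn_sym (e |: X)) u); apply: eq_n_comp_r.
rewrite add1n addSn add1n; congr _.+2.
apply: eq_card => x; rewrite !inE; case: (boolP (x \in a)) => xa;
  first by rewrite !andbF.
rewrite !andbT /roots /fingraph.root
  (@eq_pick _ _ (connect (adj (restr (e |: X))) x)) //.
move=> y; rewrite -!/(conn _ _ _) conn_setU1 -/u -/v.
move: xa; rewrite aE conn_u negb_or => /andP[xu xv].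
by rewrite !(connC X x) (negbTE xu) (negbTE xv) !orbF.
Qed.

Lemma comps_anti X Y : X \subset Y -> (comps Y <= comps X)%N.
Proof.
move=> sXY; rewrite -(setUidPr sXY).
apply: (@subset_induction _ Y (fun J => comps (X :|: J) <= comps X)%N) => //.
  by rewrite setU0.
move=> e J _ _ _; apply: leq_trans; rewrite setUCA.
case: (boolP (spans (X :|: J) e)) => [/comps_spanned -> // |].
by move/comps_unspanned->.
Qed.

(** * Bonds *)

(** If e were spanned, deleting e from the bond would leave a smaller edge set
    that still disconnects: bonds are complements of hyperplanes. *)
Lemma bond_unspanned (B : {set edge G}) e :
  bond B -> e \in B -> ~~ spans (~: B) e.
Proof.
case/minsetP=> /andP[_ cB] minB eB; apply/negP => /comps_spanned sp_e.
have BDe : ~: (B :\ e) = e |: ~: B by rewrite setCD setUC.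
have : (B :\ e != set0) && (comps setT < comps (~: (B :\ e)))%N.
  rewrite BDe sp_e cB andbT; apply: contraTneq cB => BDe0; rewrite -leqNgt.
  by rewrite -/(comps _) -sp_e -BDe BDe0 setC0.
move/minB => /(_ (subsetDl _ _)) BD; move: eB; rewrite -BD.
by rewrite !inE eqxx.
Qed.

(** The complement of a largest set that contains Z and does not span e is a
    bond: by exchange, any further edge makes this set span e, and then
    everything. *)
Lemma bond_exists Z e :
  ~~ spans Z e -> exists B : {set edge G}, [/\ bond B, e \in B & B \subset ~: Z].
Proof.
move=> nspZe.
have [W /maxsetP[nspWe maxW] sZW] :=
  @maxset_exists _ (fun W => ~~ spans W e) Z nspZe.
have spU g : g \notin W -> spans (g |: W) e.
  move=> gW; apply: contraNT gW => nsp.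
  by rewrite -(maxW _ nsp (subsetUr _ _)) !inE eqxx.
have eW : e \notin W by apply: contra nspWe; apply: spans_mem.
exists (~: W); split; rewrite ?inE ?setCS //.
apply/minsetP; split.
  apply/andP; split; first by apply/set0Pn; exists e; rewrite inE.
  rewrite setCK -!/(comps _) (comps_unspanned nspWe) ltnS.
  exact/comps_anti/subsetT.
move=> F /andP[_ cF] sFW; apply/eqP; rewrite eqEsubset sFW /=.
apply/subsetP => g; rewrite inE => gW; apply: contraLR cF => gF; rewrite -leqNgt.
have sgWF : g |: W \subset ~: F.
  by rewrite subUset sub1set inE gF /= -[W]setCK setCS.
apply: leq_trans (comps_anti sgWF) _; apply: eq_leq.
rewrite /whole -/(comps _); apply: eq_comps => h _; first exact/spans_mem/in_setT.
have [hW | hW] := boolP (h \in W); first by apply: spans_mem; rewrite !inE hW orbT.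
apply: spans_trans (spans_exchange (spU h hW) nspWe) => f /setU1P[-> | fW].
  exact: spU.
by apply: spans_mem; rewrite !inE fW orbT.
Qed.

(** * Edges of a cycle *)

(** Otherwise let S be the component of an end of e in C - e.  The degrees in C
    of the vertices of S have an even sum; but e contributes 1 to this sum, and
    every other edge of C contributes 0 or 2. *)
Lemma cycle_edge_spanned (C : gcycle G) e :
  e \in EC C -> spans (EC C :\ e) e.
Proof.
move=> eC; apply/negPn/negP => nsp.
pose S := [set x | conn (EC C :\ e) (ends e).1 x].
have /andP[_ /forall_inP deg2] := valP C.
have inVC g : g \in EC C -> ((ends g).1 \in VC C) && ((ends g).2 \in VC C).
  by apply/forall_inP: g; apply: (valP (val C)).
have S_VC x : x \in S -> x \in VC C.
  rewrite inE => /connectP[p + ->]; case: (lastP p) => [_ | q z].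
    by case/andP: (inVC _ eC).
  rewrite last_rcons rcons_path => /andP[_ /adj_restrP[g]].
  rewrite inE => /andP[_ /inVC /andP[g1 g2]].
  by case=> ends_g; rewrite ends_g in g1 g2.
have : ~~ odd (\sum_(x in S) degree (val C) x)%N.
  rewrite (eq_bigr (fun=> 2%N)) ?sum_nat_const ?oddM ?andbF // => x xS.
  exact/eqP/deg2/S_VC.
have countS a : (\sum_(x in S) (a == x))%N = (a \in S).
  have [aS | aS] := boolP (a \in S); last first.
    by rewrite big1 // => x xS; case: eqP aS => // ->; rewrite xS.
  rewrite (bigD1 a) //= eqxx big1 ?addn0 // => x /andP[_].
  by rewrite eq_sym => /negbTE ->.
have -> : (\sum_(x in S) degree (val C) x =
           \sum_(g in EC C) (((ends g).1 \in S) + ((ends g).2 \in S)))%N.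
  rewrite exchange_big; apply: eq_bigr => g _.
  by rewrite big_split /= !countS.
have e1S : (ends e).1 \in S by rewrite inE /conn connect0.
have e2S : (ends e).2 \notin S by rewrite inE.
rewrite (bigD1 e) //= e1S (negbTE e2S) addn0 add1n /= negbK.
rewrite (eq_bigr (fun g => 2 * ((ends g).1 \in S))%N) => [|g /andP[gC g_e]].
  by rewrite -big_distrr oddM.
have g_sp : spans (EC C :\ e) g by apply: spans_mem; rewrite !inE g_e.
by rewrite mul2n -addnn !inE /conn (same_connect_r (@conn_sym _) g_sp).
Qed.

(** An edge joining two components of G|Z creates no new cycle. *)
Lemma cycle_sub_setU1 (C : gcycle G) Z e :
  ~~ spans Z e -> (EC C \subset e |: Z) = (EC C \subset Z).
Proof.
move=> nspZe; apply/idP/idP => [sCeZ | ]; last first.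
  by move/subset_trans; apply; apply: subsetUr.
have eC : e \notin EC C.
  apply: contra nspZe => /cycle_edge_spanned; apply: spans_subset.
  by rewrite subDset.
apply/subsetP => g gC; have /setU1P[g_e | //] := subsetP sCeZ _ gC.
by rewrite -g_e gC in eC.
Qed.

Lemma compatible_restr (alpha : assigning G) X :
  compatible alpha (restr X) =
  [forall C : gcycle G, (EC C \subset X) ==> ~~ alpha C].
Proof. by apply: eq_forallb => C; rewrite /is_cycle_of subsetT. Qed.

Lemma compatible_setU1 (alpha : assigning G) Z e :
  ~~ spans Z e -> compatible alpha (restr (e |: Z)) = compatible alpha (restr Z).
Proof.
move=> nspZe; rewrite !compatible_restr.
by apply: eq_forallb => C; rewrite cycle_sub_setU1.
Qed.

Lemma delta_compatible (alpha : assigning G) X :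
  delta alpha X = compatible alpha (restr X).
Proof.
rewrite /delta compatible_restr.
have -> : [exists C : gcycle G, (EC C \subset X) && alpha C] =
    ~~ [forall C : gcycle G, (EC C \subset X) ==> ~~ alpha C].
  rewrite negb_forall; apply: eq_existsb => C.
  by rewrite negb_imply negbK.
by case: [forall C, _].
Qed.

(** * Active edges *)

Variable prec : rel (edge G).
Hypothesis prec_lin : linear_order prec.

(** The edges e that are least in a bond B with B :&: X contained in [set e];
    bonds are replaced by spanning so that exchange applies directly. *)
Definition active X : {set edge G} :=
  [set e | ~~ spans ((X :\ e) :|: [set g | prec g e]) e].

Lemma active_anti X Y : X \subset Y -> active Y \subset active X.
Proof.
move=> sXY; apply/subsetP => e; rewrite !inE; apply/contra/spans_subset.
exact/setSU/setSD.
Qed.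

(** Let f be active for X and different from e.  If e precedes f, the set
    that decides whether f is active already contains e.  If f precedes e and f
    became spanned, exchange would span e by the rest of X and the edges smaller
    than e. *)
Lemma active_setU1 X e : e \in active X -> active (e |: X) = active X.
Proof.
case: prec_lin => _ prec_trans prec_total.
have [eX _ | eX e_act] := boolP (e \in X); first by rewrite (setUidPr _) // sub1set.
apply/eqP; rewrite eqEsubset active_anti ?subsetUr //=.
apply/subsetP => f; rewrite !inE; set W := X :\ f :|: _ => nspWf.
have [f_e | f_e] := eqVneq f e.
  by apply: contra nspWf; apply: spans_subset;
     rewrite /W f_e setSU // setU1K // subsetD1 subxx eX.
have [ef | nef] := boolP (prec e f).
  apply: contra nspWf; apply: spans_subset; apply/subsetP => g; rewrite /W !inE.
  by case/orP => [/andP[-> /orP[/eqP -> | ->]] | ->]; rewrite ?ef ?orbT.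
have fe : prec f e by case/orP: (prec_total _ _ f_e); rewrite ?(negbTE nef).
move: e_act; rewrite inE; apply: contra => sp_f.
have {}sp_f : spans (e |: W) f.
  apply: spans_subset sp_f; apply/subsetP => g; rewrite /W !inE.
  by case/orP => [/andP[-> /orP[-> | ->]] | ->]; rewrite ?orbT.
apply: spans_subset (spans_exchange sp_f nspWf); apply/subsetP => g; rewrite /W !inE.
case/or3P => [/eqP -> | /andP[_ gX] | gf]; first by rewrite fe orbT.
- by rewrite gX andbT (contraNneq _ eX) // => <-.
- by rewrite (prec_trans _ _ _ gf fe) orbT.
Qed.

Lemma active_setU X (J : {set edge G}) :
  J \subset active X -> active (X :|: J) = active X.
Proof.
apply: (@subset_induction _ _ (fun J => active (X :|: J) = active X)).
  by rewrite setU0.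
by move=> e {}J eX _ _ IHJ; rewrite setUCA active_setU1 IHJ.
Qed.

(** Deleting edges can only add active ones, so X arises from the smaller set by
    adding edges active for that set. *)
Lemma active_setD_active X : active (X :\: active X) = active X.
Proof.
have sX : X :&: active X \subset active (X :\: active X).
  by apply: subset_trans (subsetIr _ _) (active_anti (subsetDl _ _)).
by rewrite -[in RHS](setID X (active X)) setUC active_setU.
Qed.

Lemma active_unspanned X e : e \in active X -> e \notin X -> ~~ spans X e.
Proof.
rewrite inE => nsp eX; apply: contra nsp; apply: spans_subset.
by apply/subsetP => g gX; rewrite !inE gX andbT (contraNneq _ eX) // => <-.
Qed.

(** Builds J up from set0 so that each edge joins two components of the spanning
    subgraph on X and the part of J built before it. *)
Lemma active_setU_induction X (P : {set edge G} -> Prop) :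
  [disjoint X & active X] -> P set0 ->
  (forall e (J : {set edge G}),
     e \notin J -> ~~ spans (X :|: J) e -> P J -> P (e |: J)) ->
  forall J : {set edge G}, J \subset active X -> P J.
Proof.
move=> dX P0 PU; apply: subset_induction => // e J e_act sJ eJ.
apply: PU => //; apply: active_unspanned; first by rewrite active_setU.
by rewrite inE (negbTE eJ) orbF (disjointFl dX).
Qed.

Lemma comps_setU_active X (J : {set edge G}) :
  [disjoint X & active X] -> J \subset active X ->
  comps X = (comps (X :|: J) + #|J|)%N.
Proof.
move=> dX; apply: (active_setU_induction
  (P := fun J => comps X = (comps (X :|: J) + #|J|)%N) dX)
  => {J} [|e J eJ nsp ->].
  by rewrite setU0 cards0 addn0.
by rewrite (comps_unspanned nsp) setUCA cardsU1 eJ addSnnS.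
Qed.

Lemma compatible_setU_active (alpha : assigning G) X (J : {set edge G}) :
  [disjoint X & active X] -> J \subset active X ->
  compatible alpha (restr (X :|: J)) = compatible alpha (restr X).
Proof.
move=> dX; apply: (active_setU_induction
  (P := fun J => compatible alpha (restr (X :|: J)) = compatible alpha (restr X)) dX)
  => {J} [|e J _ nsp <-].
  by rewrite setU0.
by rewrite setUCA compatible_setU1.
Qed.

(** If some edge were left unspanned, the least such edge would be
    active, because all smaller edges are spanned. *)
Lemma comps_setU_active_full X : comps (X :|: active X) = comps setT.
Proof.
have : active (X :|: active X) \subset X :|: active X.
  by rewrite active_setU // subsetUr.
move: (X :|: _) => Z actZ.
apply: eq_comps => e _; first exact/spans_mem/in_setT.
apply/negPn/negP => nspZe.
have [|f] := linear_order_min (Y := [set f | ~~ spans Z f]) prec_lin.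
  by apply/set0Pn; exists e; rewrite inE.
rewrite inE => nspZf min_f.
have : f \notin active Z.
  by apply: contra nspZf => /(subsetP actZ); apply: spans_mem.
rewrite inE negbK; apply/negP; apply: contra nspZf; apply: spans_trans => g.
rewrite !inE => /orP[/andP[_ gZ] | gf]; first exact: spans_mem.
by apply: contraLR gf => nsp; apply: min_f; rewrite inE.
Qed.

(** A bond meets X in its least edge e alone exactly when it contains e and avoids
    both the rest of X and the edges smaller than e; some bond does so exactly
    when these edges do not span e. *)
Lemma Efam_active X : (X \in Efam prec) = [disjoint X & active X].
Proof.
case: (prec_lin) => prec_irr prec_trans prec_total.
rewrite inE; apply/forall_inP/idP => [inE_X | dX B bondB].
  apply/pred0P => e /=; apply/negP => /andP[eX]; rewrite inE => nsp.
  have [B [bondB eB /subsetP sB]] := bond_exists nsp.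
  have sB' g : g \in B -> g != e -> (g \notin X) && prec e g.
    move=> gB g_e; move: (sB g gB); rewrite !inE g_e /= negb_or => /andP[-> /= ge].
    by case/orP: (prec_total _ _ g_e); rewrite ?(negbTE ge).
  apply/negP: (inE_X B bondB); rewrite negbK; apply/eqP/setP => g; rewrite !inE.
  have [-> | g_e] := eqVneq g e.
    rewrite eX eB /=; symmetry; apply/forall_inP => h hB.
    by apply/implyP => h_e; case/andP: (sB' h hB h_e).
  have [gB | //] := boolP (g \in B); last by rewrite andbF.
  case/andP: (sB' g gB g_e) => /negbTE -> eg /=; symmetry; apply/negbTE.
  apply/forall_inPn; exists e => //=; rewrite eq_sym g_e /=.
  by apply/negP => ge; move: (prec_irr e); rewrite (prec_trans _ _ _ eg ge).
have [|e eB min_e] := linear_order_min (Y := B) prec_lin.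
  by case/minsetP: bondB => /andP[].
apply/negP => /eqP XB.
have e_min : e \in min1 prec B.
  rewrite !inE eB; apply/forall_inP => g gB; apply/implyP => g_e.
  by case/orP: (prec_total _ _ g_e) (min_e g gB) => // ->.
have /setIP[eX _] : e \in X :&: B by rewrite XB.
have := disjointFr dX eX; rewrite inE => /negbFE sp_e.
apply/negP: (bond_unspanned bondB eB); rewrite negbK; apply: spans_subset sp_e.
apply/subsetP => g; rewrite !inE => /orP[/andP[g_e gX] | ge].
  apply: contra g_e => gB; have : g \in min1 prec B by rewrite -XB inE gX.
  rewrite !inE => /andP[_ /forall_inP /(_ e eB)]; rewrite eq_sym.
  by case: eqP => //= _; rewrite (negbTE (min_e g gB)).
by apply: contraL ge; apply: min_e.
Qed.

End Connectivity.

(** * The expansion *)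

Section Expansion.

Variables (G : mgraph) (alpha : assigning G) (prec : rel (edge G)).
Hypothesis prec_lin : linear_order prec.
Implicit Types (X Z : {set edge G}).

(** Spanning subgraphs are determined by their edge sets. *)
Lemma sum_spanning (F : subgraph G -> {poly int}) :
  \sum_(H : subgraph G | spanning H && compatible alpha H) F H =
  \sum_X (delta alpha X)%:R * F (restr X).
Proof.
rewrite (reindex_onto (@restr G) (@ES G)); last first.
  move=> H /andP[/eqP VH _]; apply/val_inj => /=; rewrite -VH.
  exact/esym/surjective_pairing.
rewrite big_mkcond; apply: eq_bigr => X _.
rewrite delta_compatible [spanning _]eqxx eqxx andbT /=.
by case: compatible; rewrite ?mul1r ?mul0r.
Qed.

Lemma compatible_expansion :
  \sum_Z (delta alpha Z)%:R * ((-1) ^+ #|Z| * 'X ^+ (comps Z - comps [set: edge G])) =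
  \sum_(X in Efam prec) (delta alpha X)%:R * (-1) ^+ #|X|
    * ('X - 1 : {poly int}) ^+ (comps X - comps [set: edge G]).
Proof.
pose act := active prec.
rewrite (partition_big (fun Z => Z :\: act Z) (fun X => X \in Efam prec))
  => [|Z _]; last first.
  rewrite Efam_active // active_setD_active //.
  by rewrite -setI_eq0 setIDAC setDIl setDv setI0.
apply: eq_bigr => X; rewrite Efam_active // => dX.
(* The sets Z in the block of X are X :|: J for J contained in act X. *)
rewrite (reindex_onto (fun J => X :|: J) (fun Z => Z :&: act Z)) => [|Z]; last first.
  by move/eqP <-; rewrite setUC setID.
have c_act : (comps X - comps [set: edge G] = #|act X|)%N.
  rewrite (comps_setU_active prec_lin dX (subxx _)) comps_setU_active_full //.
  by rewrite addKn.
rewrite c_act -expr_signed_subset_sum mulr_sumr.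
have intervalE J :
    ((X :|: J) :\: act (X :|: J) == X) && ((X :|: J) :&: act (X :|: J) == J) =
    (J \subset act X).
  apply/andP/idP => [[/eqP X_def /eqP J_def] | sJ].
    rewrite -X_def /act active_setD_active // -{1}J_def.
    exact: subsetIr.
  rewrite /act active_setU // setDUl setIUl (setDidPl dX) (setIidPl sJ).
  move: dX sJ; rewrite -setI_eq0 -setD_eq0 => /eqP -> /eqP ->.
  by rewrite setU0 set0U !eqxx.
rewrite (eq_bigl _ _ intervalE); apply: eq_bigr => J sJ.
rewrite !delta_compatible (compatible_setU_active prec_lin alpha dX sJ).
have dXJ : X :&: J = set0.
  by apply/eqP; rewrite setI_eq0 (disjointWr sJ).
have -> : (comps (X :|: J) - comps [set: edge G] = #|act X| - #|J|)%N.
  by rewrite -c_act (comps_setU_active prec_lin dX sJ) subnAC addnK.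
by rewrite cardsU dXJ cards0 subn0 exprD -!mulrA.
Qed.

End Expansion.

(* The factor 'X ^+ c(G) / ('X - 1) ^+ c(G) in the second formula is needed: for
   a single vertex without edges the polynomial is 'X, not 'X - 1. *)
Theorem corollary3p6 (G : mgraph) (D : orientation G)
    (o : gcycle G -> orientation G)
    (o_dir : forall C : gcycle G, is_direction C (o C))
    (alpha : assigning G) (alpha_adm : admissible D o alpha)
    (prec : rel (edge G)) (prec_lin : linear_order prec) :
  tension_poly alpha =
    \sum_(X in Efam prec) (delta alpha X)%:R * (-1) ^+ #|X|
      * ('X - 1) ^+ (rk (whole G) - rk (restr X))
  /\
  assigning_poly alpha =
    \sum_(X in Efam prec) (delta alpha X)%:R * (-1) ^+ #|X|
      * ('X ^+ ncomp (whole G)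
         * ('X - 1) ^+ (ncomp (restr X) - ncomp (whole G))).
Proof.
have comps_min (X : {set edge G}) : (comps [set: edge G] <= comps X)%N.
  exact/comps_anti/subsetT.
have rkE (X : {set edge G}) :
    (rk (whole G) - rk (restr X) = comps X - comps [set: edge G])%N.
  have : (comps X <= #|vert G|)%N by apply: max_card.
  by rewrite /rk -!/(comps _); move: (comps_min X); lia.
split; rewrite /tension_poly /assigning_poly sum_spanning.
  under [RHS]eq_bigr do rewrite rkE.
  rewrite -compatible_expansion //; apply: eq_bigr => X _.
  by rewrite rkE.
under [RHS]eq_bigr do rewrite mulrCA.
rewrite -mulr_sumr -compatible_expansion // mulr_sumr; apply: eq_bigr => X _.
by rewrite -!/(comps _) -[in LHS](subnKC (comps_min X)) exprD; ring.
Qed.
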